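(* Let $T_K$ be the integral operator with separable kernel $K(x,y)=\sum_{i=1}^N\sum_{j=1}^M a_{i,j}p_i(x)q_j(y)$ and weight $w$ on $\mathcal D$, and let $\lambda_i,\ell_i$ ($i=1,\dots,r$), $\Sigma$, $\phi_i^{(j)}$, $\psi_i^{(j)}$ be the data obtained from a full system of chains of generalized eigenvectors of $BA$ as described in the context. Let $g$ be a function on $\mathcal D$ and let $z\in\mathbb C$, $z\neq 0$, be different from each of $\lambda_1,\dots,\lambda_r$. Let $\bm{\beta}\in\mathbb C^M$ be the column vector whose $(\sum_{k=1}^{i-1}\ell_k+j)$th entry is $\langle g,\psi_i^{(j)}\rangle$ ($i=1,\dots,r$, $j=1,\dots,\ell_i$). Then $\Sigma-zI_M$ is nonsingular, and if $\bm{\alpha}=\frac1z(\Sigma-zI_M)^{-1}\bm{\beta}$ and $\alpha_i^{(j)}$ denotes the $(\sum_{k=1}^{i-1}\ell_k+j)$th entry of $\bm{\alpha}$, then the function $$f(x)=-\frac1z g(x)+\sum_{i=1}^r\sum_{j=1}^{\ell_i}\alpha_i^{(j)}\phi_i^{(j)}(x)$$ is a solution of the Fredholm integral equation of the second kind $T_Kf(x)=zf(x)+g(x)$.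
   Context: $\mathcal D\subset\mathbb R$ is a closed interval and $w$ is a weight function on $\mathcal D$. $p_1,\dots,p_N$ are linearly independent functions on $\mathcal D$, $q_1,\dots,q_M$ are linearly independent functions on $\mathcal D$, and $A=(a_{i,j})$ is an $N\times M$ matrix of scalars. The separable kernel is $K(x,y)=\sum_{i=1}^N\sum_{j=1}^M a_{i,j}p_i(x)q_j(y)$. The integral operator is $T_Kf(x)=\int_{\mathcal D}K(x,y)f(y)w(y)\,dy$, and it is assumed that all the integrals involved (including those with $f=g$) converge. Write $\langle f,q\rangle=\int_{\mathcal D}f(x)q(x)w(x)\,dx$ (no complex conjugation). $B$ is the $M\times N$ matrix whose entry in row $j$ and column $i$ is $\langle p_i,q_j\rangle$. Let $\bm{u}_i^{(j)}\in\mathbb C^M$ ($i=1,\dots,r$, $j=1,\dots,\ell_i$, $\ell_1+\cdots+\ell_r=M$) be linearly independent vectors forming Jordan chains of $BA$: $(BA-\lambda_iI_M)\bm{u}_i^{(1)}=\bm{0}$ and $(BA-\lambda_iI_M)\bm{u}_i^{(j+1)}=\bm{u}_i^{(j)}$ for $j=1,\dots,\ell_i-1$ (the $\lambda_i$ for different $i$ need not be distinct). Put $\bm{v}_i^{(j)}=A\bm{u}_i^{(j)}\in\mathbb C^N$. Let $U$ be the invertible $M\times M$ matrix and $V=AU$ the $N\times M$ matrix with columns $\bm{u}_i^{(j)}$, respectively $\bm{v}_i^{(j)}$, in the order $(1,1),\dots,(1,\ell_1),\dots,(r,1),\dots,(r,\ell_r)$ of the indices $(i,j)$. Let $\Sigma=\mathrm{diag}(\Lambda_1,\dots,\Lambda_r)$,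 where $\Lambda_i$ is the $\ell_i\times\ell_i$ upper triangular Jordan block with $\lambda_i$ on the diagonal and $1$ on the superdiagonal. With column vectors $\bm{p}(x)=(p_1(x),\dots,p_N(x))^\top$ and $\bm{q}(y)=(q_1(y),\dots,q_M(y))^\top$, set $\Phi(x)=V^\top\bm{p}(x)$ and $\Psi(y)=U^{-1}\bm{q}(y)$; $\phi_i^{(j)}(x)$ and $\psi_i^{(j)}(y)$ denote the $(\sum_{k=1}^{i-1}\ell_k+j)$th entries of $\Phi(x)$ and $\Psi(y)$. *)

(* Defs.v *)
From HB Require Import structures.
From mathcomp Require Import all_boot all_order all_algebra.
From mathcomp Require Import all_classical all_reals all_analysis.
From mathcomp Require Import complex.

Set Implicit Arguments.
Unset Strict Implicit.
Unset Printing Implicit Defensive.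

Import Order.TTheory GRing.Theory Num.Theory.
Import numFieldNormedType.Exports.

Local Open Scope classical_set_scope.
Local Open Scope ring_scope.
Local Open Scope complex_scope.

Section ComplexIntegral.
Variables (R : realType) (D : set R).

Definition cintegrable (h : R -> R[i]) : Prop :=
  (@lebesgue_measure R).-integrable D (fun x => (complex.Re (h x))%:E) /\
  (@lebesgue_measure R).-integrable D (fun x => (complex.Im (h x))%:E).

Definition cintegral (h : R -> R[i]) : R[i] :=
  (\int[@lebesgue_measure R]_(x in D) complex.Re (h x)) +i*
  (\int[@lebesgue_measure R]_(x in D) complex.Im (h x)).

End ComplexIntegral.

Section SeparableKernel.
Variables (R : realType) (D : set R).
Local Notation C := R[i].

(* Functions on D are total functions of which only the values on D matter. *)

(* D may be bounded or not: [a, b], [a, +oo[, ]-oo, b] or the whole line. *)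
Definition closed_interval : Prop := is_interval D /\ closed D.

Definition weight_function (w : R -> R) : Prop :=
  measurable_fun D w /\ forall x, D x -> 0 <= w x.

Definition lin_indep_on (n : nat) (p : 'I_n -> R -> C) : Prop :=
  forall c : 'I_n -> C,
    (forall x, D x -> \sum_(i < n) c i * p i x = 0) -> forall i, c i = 0.

Variable w : R -> R.

(* No complex conjugation. *)
Definition wpair (f q : R -> C) : C :=
  cintegral D (fun x => f x * q x * (w x)%:C).

Definition wpair_converges (f q : R -> C) : Prop :=
  cintegrable D (fun x => f x * q x * (w x)%:C).

Definition integral_operator (K : R -> R -> C) (f : R -> C) (x : R) : C :=
  cintegral D (fun y => K x y * f y * (w y)%:C).

(* cintegral is total, so convergence of the integral defining T_K f(x) is
   required explicitly of a solution. *)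
Definition fredholm2_solution (K : R -> R -> C) (z : C) (g f : R -> C) : Prop :=
  forall x, D x ->
    cintegrable D (fun y => K x y * f y * (w y)%:C) /\
    integral_operator K f x = z * f x + g x.

Variables (N M : nat) (p : 'I_N -> R -> C) (q : 'I_M -> R -> C).

Definition separable_kernel (A : 'M[C]_(N, M)) (x y : R) : C :=
  \sum_(i < N) \sum_(j < M) A i j * p i x * q j y.

Definition Bmatrix : 'M[C]_(M, N) := \matrix_(j < M, i < N) wpair (p i) (q j).

End SeparableKernel.

Section JordanData.
Variables (F : fieldType) (M r : nat) (l : 'I_r -> nat).

Definition jordan_chains (T : 'M[F]_M) (lambda : 'I_r -> F)
    (u : forall i : 'I_r, 'I_(l i) -> 'cV[F]_M) : Prop :=
  (forall (i : 'I_r) (j : 'I_(l i)), j = 0%N :> nat ->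
     (T - (lambda i)%:M) *m u i j = 0) /\
  (forall (i : 'I_r) (j k : 'I_(l i)), k = j.+1 :> nat ->
     (T - (lambda i)%:M) *m u i k = u i j).

Definition lin_indep_family (u : forall i : 'I_r, 'I_(l i) -> 'cV[F]_M) : Prop :=
  free [seq u (tag s) (tagged s) | s : {i : 'I_r & 'I_(l i)}].

Definition jordan_block (n : nat) (a : F) : 'M[F]_n :=
  \matrix_(i < n, j < n)
    (if i == j then a else if j == i.+1 :> nat then 1 else 0).

Hypothesis hM : (\sum_(i < r) l i)%N = M.

(* The position l_0 + ... + l_(i-1) + j of the index (i, j), counting from 0;
   see chain_posE. *)
Definition chain_pos (i : 'I_r) (j : 'I_(l i)) : 'I_M :=
  cast_ord hM (tagnat.Rank i j).

Definition Umatrix (u : forall i : 'I_r, 'I_(l i) -> 'cV[F]_M) : 'M[F]_M :=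
  castmx (erefl M, hM)
    (\mxrow_(i < r) (\matrix_(k < M, j < l i) u i j k 0)).

Definition Sigma (lambda : 'I_r -> F) : 'M[F]_M :=
  castmx (hM, hM) (\mxdiag_(i < r) jordan_block (l i) (lambda i)).

Lemma chain_posE (i : 'I_r) (j : 'I_(l i)) :
  chain_pos j = (\sum_(k < r | (k < i)%N) l k + j)%N :> nat.
Proof. exact: tagnat.RankEsum. Qed.

Lemma col_Umatrix (u : forall i : 'I_r, 'I_(l i) -> 'cV[F]_M)
    (i : 'I_r) (j : 'I_(l i)) :
  col (chain_pos j) (Umatrix u) = u i j.
Proof.
apply/matrixP => k c; rewrite (ord1 c) !mxE castmxE cast_ord_id /chain_pos cast_ordK.
have := congr1 (fun B : 'M[F]_(M, l i) => B k j)
  (mxrowK (fun i => \matrix_(k < M, j < l i) u i j k 0) i).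
by rewrite !mxE.
Qed.

Lemma Sigma_block (lambda : 'I_r -> F) (i : 'I_r) (j k : 'I_(l i)) :
  Sigma lambda (chain_pos j) (chain_pos k) = jordan_block (l i) (lambda i) j k.
Proof.
rewrite castmxE /chain_pos !cast_ordK.
have := congr1 (fun B : 'M[F]_(l i) => B j k)
  (submxblock_diag (fun i => jordan_block (l i) (lambda i)) i).
by rewrite [LHS]mxE.
Qed.

End JordanData.

Section Singular.
Variables (R : realType) (N M r : nat) (l : 'I_r -> nat).
Hypothesis hM : (\sum_(i < r) l i)%N = M.
Local Notation C := R[i].
Variables (A : 'M[C]_(N, M)) (u : forall i : 'I_r, 'I_(l i) -> 'cV[C]_M).

Definition Vmatrix : 'M[C]_(N, M) := A *m Umatrix hM u.

Definition Phi (p : 'I_N -> R -> C) (x : R) : 'cV[C]_M :=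
  Vmatrix^T *m (\col_(i < N) p i x).

Definition Psi (q : 'I_M -> R -> C) (y : R) : 'cV[C]_M :=
  invmx (Umatrix hM u) *m (\col_(j < M) q j y).

Definition phi (p : 'I_N -> R -> C) (i : 'I_r) (j : 'I_(l i)) (x : R) : C :=
  Phi p x (chain_pos hM j) 0.

Definition beta (D : set R) (w : R -> R) (q : 'I_M -> R -> C) (g : R -> C) :
    'cV[C]_M :=
  \col_(k < M) wpair D w g (fun y => Psi q y k 0).

Definition alpha (lambda : 'I_r -> C) (D : set R) (w : R -> R)
    (q : 'I_M -> R -> C) (g : R -> C) (z : C) : 'cV[C]_M :=
  z^-1 *: (invmx (Sigma hM lambda - z%:M) *m beta D w q g).

End Singular.

(* Main.v *)
Require Import Defs.
From HB Require Import structures.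
From mathcomp Require Import all_boot all_order all_algebra.
From mathcomp Require Import all_classical all_reals all_analysis.
From mathcomp Require Import complex.

Set Implicit Arguments.
Unset Strict Implicit.
Unset Printing Implicit Defensive.

Import Order.TTheory GRing.Theory Num.Theory.
Import numFieldNormedType.Exports.

Local Open Scope classical_set_scope.
Local Open Scope ring_scope.
Local Open Scope complex_scope.


(** Since the kernel is separable, [T_K f] depends on [f] only through the
    column [b(f)] of the pairings [<f, q_j>]:
    [T_K f(x) = p(x)^T A b(f)] ([integral_operator_separable]).  So the
    integral equation is a finite linear system in disguise.

    The proposed solution is [f = - z^-1 g + p^T c] with [c = A U alpha].
    By linearity of the pairing ([wpair_affinel]),
    [b(f) = - z^-1 b(g) + B A U alpha].  The chain relations say
    [B A U = U Sigma] ([mulmx_Umatrix]), and, as [Psi = U^-1 q], one has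
    [b(g) = U beta] ([Umatrix_unit], [wpair_lincombr]).  Therefore
    [b(f) = U (Sigma alpha - z^-1 beta)], and the definition of [alpha],
    [(Sigma - z) alpha = z^-1 beta], makes this [z U alpha].  Consequently
    [T_K f(x) = z p(x)^T A U alpha = z p(x)^T c = z f(x) + g(x)].

    The matrix [Sigma - z] is invertible because it is block diagonal with
    triangular blocks whose diagonal entries are the nonzero numbers
    [lambda_i - z] ([Sigma_sub_unit]). *)

(** * Linearity of the complex-valued integral *)

Section ComplexIntegralLinear.
Variables (R : realType) (D : set R).
Hypothesis mD : measurable (D : set (measurableTypeR R)).
Local Notation C := R[i].
Local Notation mu := (@lebesgue_measure R).

Let ReD (a b : C) : complex.Re (a + b) = complex.Re a + complex.Re b.
Proof. by case: a b => [? ?] []. Qed.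

Let ImD (a b : C) : complex.Im (a + b) = complex.Im a + complex.Im b.
Proof. by case: a b => [? ?] []. Qed.

(* Written as a sum so that real and imaginary parts of a product are both
   instances of the combination [a * f + b * h] treated below. *)
Let ReM (a b : C) :
  complex.Re (a * b)
  = complex.Re a * complex.Re b + - complex.Im a * complex.Im b.
Proof. by case: a b => [? ?] [? ?] /=; rewrite mulNr. Qed.

Let ImM (a b : C) :
  complex.Im (a * b)
  = complex.Re a * complex.Im b + complex.Im a * complex.Re b.
Proof. by case: a b => [? ?] []. Qed.

Let integrable_lin (a b : R) (f h : R -> R) :
  mu.-integrable D (EFin \o f) -> mu.-integrable D (EFin \o h) ->
  mu.-integrable D (fun x => (a * f x + b * h x)%:E).
Proof.
by move=> fi hi; exact: (integrableD mD (integrableZl mD a fi) (integrableZl mD b hi)).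
Qed.

Let Rintegral_lin (a b : R) (f h : R -> R) :
  mu.-integrable D (EFin \o f) -> mu.-integrable D (EFin \o h) ->
  \int[mu]_(x in D) (a * f x + b * h x)
  = a * \int[mu]_(x in D) f x + b * \int[mu]_(x in D) h x.
Proof.
move=> fi hi; rewrite RintegralD ?RintegralZl //.
- exact: (integrableZl mD a fi).
- exact: (integrableZl mD b hi).
Qed.

Lemma cintegrable0 : cintegrable D (fun=> 0 : C).
Proof. by split; exact: integrable0. Qed.

Lemma cintegral0 : cintegral D (fun=> 0 : C) = 0.
Proof. by rewrite /cintegral /= /Rintegral integral0. Qed.

Lemma cintegrableD (f h : R -> C) : cintegrable D f -> cintegrable D h ->
  cintegrable D (fun x => f x + h x).
Proof.
move=> [f1 f2] [h1 h2]; split.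
- under eq_fun do rewrite ReD; exact: (integrableD mD f1 h1).
- under eq_fun do rewrite ImD; exact: (integrableD mD f2 h2).
Qed.

Lemma cintegralD (f h : R -> C) : cintegrable D f -> cintegrable D h ->
  cintegral D (fun x => f x + h x) = cintegral D f + cintegral D h.
Proof.
move=> [f1 f2] [h1 h2]; rewrite /cintegral.
under eq_Rintegral do rewrite ReD.
under [X in _ +i* X]eq_Rintegral do rewrite ImD.
by rewrite !RintegralD.
Qed.

Lemma cintegrableZ (a : C) (f : R -> C) : cintegrable D f ->
  cintegrable D (fun x => a * f x).
Proof.
move=> [f1 f2]; split.
- under eq_fun do rewrite ReM; exact: integrable_lin.
- under eq_fun do rewrite ImM; exact: integrable_lin.
Qed.

Lemma cintegralZ (a : C) (f : R -> C) : cintegrable D f ->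
  cintegral D (fun x => a * f x) = a * cintegral D f.
Proof.
move=> [f1 f2]; rewrite /cintegral.
under eq_Rintegral do rewrite ReM.
under [X in _ +i* X]eq_Rintegral do rewrite ImM.
rewrite !Rintegral_lin //; by case: a => a1 a2; rewrite /= mulNr.
Qed.

Lemma cintegral_lincomb (I : finType) (c : I -> C) (h : I -> R -> C) :
  (forall i, cintegrable D (h i)) ->
  cintegrable D (fun x => \sum_i c i * h i x) /\
  cintegral D (fun x => \sum_i c i * h i x) = \sum_i c i * cintegral D (h i).
Proof.
move=> hi; elim: (index_enum I) => [|i s [IHi IHe]].
  under eq_fun do rewrite big_nil.
  by rewrite big_nil cintegral0; split=> //; exact: cintegrable0.
under eq_fun do rewrite big_cons.
rewrite big_cons; split; first exact/cintegrableD/IHi/cintegrableZ.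
by rewrite cintegralD ?cintegralZ ?IHe //; exact: cintegrableZ.
Qed.

End ComplexIntegralLinear.

(** * The pairing and the integral operator with separable kernel *)

Section WeightedPairing.
Variables (R : realType) (D : set R) (w : R -> R).
Hypothesis mD : measurable (D : set (measurableTypeR R)).
Local Notation C := R[i].

Lemma wpair_lincombr (I : finType) (c : I -> C) (f : R -> C) (q : I -> R -> C) :
  (forall i, wpair_converges D w f (q i)) ->
  wpair D w f (fun y => \sum_i c i * q i y) = \sum_i c i * wpair D w f (q i).
Proof.
move=> fq; rewrite -(cintegral_lincomb mD c fq).2; congr cintegral.
apply/funext => y; rewrite mulr_sumr mulr_suml; apply: eq_bigr => i _.
by rewrite mulrCA !mulrA.
Qed.

(** Convergence is part of the conclusion because a solution of the integral
    equation must make the integral defining [T_K f] converge. *)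
Lemma wpair_affinel (I : finType) (a : C) (c : I -> C) (g q : R -> C)
    (p : I -> R -> C) :
  wpair_converges D w g q -> (forall i, wpair_converges D w (p i) q) ->
  wpair_converges D w (fun y => a * g y + \sum_i c i * p i y) q /\
  wpair D w (fun y => a * g y + \sum_i c i * p i y) q
  = a * wpair D w g q + \sum_i c i * wpair D w (p i) q.
Proof.
move=> gq pq; have [li le] := cintegral_lincomb mD c pq.
have gi := cintegrableZ mD a gq.
rewrite /wpair_converges /wpair.
have -> : (fun y => (a * g y + \sum_i c i * p i y) * q y * (w y)%:C)
  = (fun y => a * (g y * q y * (w y)%:C)
              + \sum_i c i * (p i y * q y * (w y)%:C)).
  apply/funext => y; rewrite !mulrDl !mulr_suml !mulrA; congr (_ + _).
  by apply: eq_bigr => i _; rewrite !mulrA.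
split; first exact: cintegrableD.
by rewrite cintegralD // cintegralZ // le.
Qed.

(** For fixed [x] the integrand is the linear combination, with coefficients
    [(p(x)^T A)_j], of the integrands of the pairings [<f, q_j>]. *)
Lemma integral_operator_separable (N M : nat) (p : 'I_N -> R -> C)
    (q : 'I_M -> R -> C) (A : 'M[C]_(N, M)) (f : R -> C) (x : R) :
  (forall j, wpair_converges D w f (q j)) ->
  cintegrable D (fun y => separable_kernel p q A x y * f y * (w y)%:C) /\
  integral_operator D w (separable_kernel p q A) f x
  = \sum_i p i x * (A *m \col_j wpair D w f (q j)) i 0.
Proof.
move=> fq; have [li le] := cintegral_lincomb mD (fun j => \sum_i p i x * A i j) fq.
rewrite /integral_operator.
have -> : (fun y => separable_kernel p q A x y * f y * (w y)%:C)
  = (fun y => \sum_j (\sum_i p i x * A i j) * (f y * q j y * (w y)%:C)).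
  apply/funext => y; rewrite /separable_kernel exchange_big /= !mulr_suml.
  apply: eq_bigr => j _; rewrite !mulr_suml; apply: eq_bigr => i _.
  by rewrite (mulrC (A i j)) (mulrC (f y)) !mulrA.
split=> //; rewrite le.
under eq_bigr do rewrite mulr_suml.
rewrite exchange_big; apply: eq_bigr => i _; rewrite mxE mulr_sumr.
by apply: eq_bigr => j _; rewrite mxE mulrA.
Qed.

End WeightedPairing.

(** * Linear algebra of the Jordan chains *)

Section JordanAlgebra.
Variables (F : fieldType) (M r : nat) (l : 'I_r -> nat).
Hypothesis hM : (\sum_(i < r) l i)%N = M.

Lemma sum_chain_pos (V : nmodType) (f : 'I_M -> V) :
  \sum_(k < M) f k = \sum_(i < r) \sum_(j < l i) f (chain_pos hM j).
Proof.
pose h (t : {i : 'I_r & 'I_(l i)}) := cast_ord hM (tagnat.rank t).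
have hb : bijective h.
  apply: (bij_comp _ tagnat.rank_bij).
  by exists (cast_ord (esym hM)); [exact: cast_ordK | exact: cast_ordKV].
rewrite (reindex h) /=; last exact: onW_bij.
by rewrite sig_big_dep; apply: eq_bigr => t _; rewrite /h tagnat.rankE.
Qed.

Lemma free_codom_lincomb (vT : vectType F) (T : finType) (f : T -> vT)
    (c : T -> F) :
  free [seq f t | t : T] -> \sum_t c t *: f t = 0 -> forall t, c t = 0.
Proof.
move=> /(@freeP _ _ _ (codom_tuple f)) freef cf0 t.
rewrite -[t]enum_rankK; apply: (freef (fun k => c (enum_val k))).
rewrite -[RHS]cf0 [RHS](_ : _ = \sum_(t in T) c t *: f t); last exact: eq_bigl.
rewrite [RHS]big_enum_val /=.
by apply: eq_bigr => k _; rewrite [tval _]/= nth_image.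
Qed.

(** A vector in the kernel of [U] is a vanishing linear combination of the
    chain vectors, which are the columns of [U]. *)
Lemma Umatrix_unit (u : forall i : 'I_r, 'I_(l i) -> 'cV[F]_M) :
  lin_indep_family u -> Umatrix hM u \in unitmx.
Proof.
move=> freeu; rewrite -unitmx_tr -row_free_unit.
apply: inj_row_free => v vU0.
have vpos0 := free_codom_lincomb (c := fun s => v 0 (chain_pos hM (tagged s))) freeu.
have {}vpos0 i (j : 'I_(l i)) : v 0 (chain_pos hM j) = 0.
  apply: (vpos0 _ (Tagged _ j)).
  transitivity (\sum_i \sum_(j < l i) v 0 (chain_pos hM j) *: u i j).
    by rewrite sig_big_dep.
  under eq_bigr do under eq_bigr do rewrite -(col_Umatrix hM).
  rewrite -(sum_chain_pos (fun k => v 0 k *: col k (Umatrix hM u))).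
  apply/trmx_inj; rewrite trmx0 -vU0; apply/rowP => a.
  rewrite !mxE summxE; apply: eq_bigr => k _; by rewrite !mxE.
apply/rowP => k; rewrite mxE -(cast_ordKV hM k) -(tagnat.sigK (cast_ord _ k)).
by rewrite tagnat.rankE; apply: vpos0.
Qed.

(** Column by column: [T] sends [u_i^(j)] to
    [lambda_i u_i^(j) + u_i^(j-1)], which is how the Jordan block combines the
    columns of the [i]-th chain. *)
Lemma mulmx_Umatrix (T : 'M[F]_M) (lambda : 'I_r -> F)
    (u : forall i : 'I_r, 'I_(l i) -> 'cV[F]_M) :
  jordan_chains T lambda u -> T *m Umatrix hM u = Umatrix hM u *m Sigma hM lambda.
Proof.
move=> [chain0 chainS]; rewrite /Umatrix /Sigma.
(* Taking [M] to be the sum of the chain lengths makes the casts trivial. *)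
case: _ / hM T u chain0 chainS => T u chain0 chainS.
rewrite !castmx_id mul_mxrow mul_mxrow_mxdiag; apply: eq_mxrow => i.
(* The sum has one term, the predecessor of [j] in the chain, or none when
   [j] starts the chain: this treats both kinds of chain relation at once. *)
have Tu (j : 'I_(l i)) :
    T *m u i j = lambda i *: u i j
      + \sum_(k < l i | j == k.+1 :> nat) u i k.
  apply/eqP; rewrite addrC -subr_eq -mul_scalar_mx -mulmxBl; apply/eqP.
  case: j => [[|j] ltj] /=; first by rewrite [RHS]big_pred0 // chain0.
  rewrite [RHS](big_pred1 (Ordinal (ltnW ltj))); first exact: chainS.
  by move=> k; rewrite /= eqSS eq_sym.
apply/matrixP => a j.
transitivity ((T *m u i j) a 0).
  by rewrite !mxE; apply: eq_bigr => k _; rewrite !mxE.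
rewrite Tu !mxE summxE [RHS](bigD1 j) //= !mxE eqxx mulrC; congr (_ + _).
rewrite [LHS]big_mkcond [RHS]big_mkcond; apply: eq_bigr => k _ /=.
rewrite !mxE; have [->|_] := eqVneq k j; first by rewrite ltn_eqF.
by case: ifP; rewrite ?mulr1 ?mulr0.
Qed.

(** The transpose is lower triangular, so the determinant is
    [(a - z) ^+ n]. *)
Lemma jordan_block_sub_unit (n : nat) (a z : F) :
  z != a -> jordan_block n a - z%:M \in unitmx.
Proof.
move=> za; rewrite -unitmx_tr unitmxE det_trig.
  rewrite unitfE; apply/prodf_neq0 => i _.
  by rewrite !mxE eqxx subr_eq0 eq_sym.
apply/is_trig_mxP => i j ij.
by rewrite !mxE -!val_eqE /= (gtn_eqF ij) (ltn_eqF (leqW ij)) subr0.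
Qed.

(** The witness for the inverse applies each [invmx (B i)] to the [i]-th
    horizontal slice of the identity matrix. *)
Lemma mxdiag_unit (B : forall i : 'I_r, 'M[F]_(l i)) :
  (forall i, B i \in unitmx) -> \mxdiag_i B i \in unitmx.
Proof.
move=> Bu.
apply: (proj1 (mulmx1_unit (B := \mxcol_i (invmx (B i) *m submxcol 1%:M i)) _)).
rewrite mul_mxdiag_mxcol -[RHS]submxcolK; apply: eq_mxcol => i.
by rewrite mulKVmx.
Qed.

Lemma Sigma_sub_unit (lambda : 'I_r -> F) (z : F) :
  (forall i, z != lambda i) -> Sigma hM lambda - z%:M \in unitmx.
Proof.
move=> zl; rewrite /Sigma; case: _ / hM; rewrite castmx_id -mxdiagZ -mxdiagB.
by apply: mxdiag_unit => i; exact: jordan_block_sub_unit.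
Qed.

End JordanAlgebra.

Theorem mainTheorem2 (R : realType) (D : set R) (w : R -> R)
    (N M r : nat) (p : 'I_N -> R -> R[i]) (q : 'I_M -> R -> R[i])
    (A : 'M[R[i]]_(N, M))
    (l : 'I_r -> nat) (hM : (\sum_(i < r) l i)%N = M)
    (lambda : 'I_r -> R[i])
    (u : forall i : 'I_r, 'I_(l i) -> 'cV[R[i]]_M)
    (g : R -> R[i]) (z : R[i])
    (hD : closed_interval D)
    (hw : weight_function D w)
    (hp : lin_indep_on D p)
    (hq : lin_indep_on D q)
    (hpq : forall (i : 'I_N) (j : 'I_M), wpair_converges D w (p i) (q j))
    (hgq : forall j : 'I_M, wpair_converges D w g (q j))
    (hl : forall i : 'I_r, (0 < l i)%N)
    (hu : lin_indep_family u)
    (hchain : jordan_chains (Bmatrix D w p q *m A) lambda u)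
    (hz0 : z != 0)
    (hz : forall i : 'I_r, z != lambda i) :
  (Sigma hM lambda - z%:M) \in unitmx /\
  fredholm2_solution D w (separable_kernel p q A) z g
    (fun x => - (z^-1 * g x)
       + \sum_(i < r) \sum_(j < l i)
           alpha hM u lambda D w q g z (chain_pos hM j) 0 * phi hM A u p j x).
Proof.
have mD : measurable (D : set (measurableTypeR R)).
  exact: measurable_realfun.closed_measurable hD.2.
have SzU := Sigma_sub_unit hM hz; split=> //.
set a := alpha _ _ _ _ _ _ _ _.
have aE : Sigma hM lambda *m a - z *: a = z^-1 *: beta hM u D w q g.
  by rewrite -mul_scalar_mx -mulmxBl /a /alpha -scalemxAr mulKVmx.
(* Only the linear system that [alpha] solves matters from here on. *)
move: a aE => a aE.
set f := (fun x => _ + _).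
pose U := Umatrix hM u; pose c := A *m U *m a.
have Uunit : U \in unitmx := Umatrix_unit hM hu.
have fE y : f y = - z^-1 * g y + \sum_i c i 0 * p i y.
  rewrite /f -(sum_chain_pos hM (fun k => a k 0 * Phi hM A u p y k 0)) mulNr.
  congr (_ + _).
  under eq_bigr do rewrite mxE mulr_sumr.
  rewrite exchange_big /=; apply: eq_bigr => i _.
  rewrite [c i 0]mxE mulr_suml; apply: eq_bigr => k _.
  by rewrite !mxE mulrA (mulrC (a k 0)).
have fq j : wpair_converges D w f (q j) /\ wpair D w f (q j)
    = - z^-1 * wpair D w g (q j) + \sum_i c i 0 * wpair D w (p i) (q j).
  have -> : f = (fun y => - z^-1 * g y + \sum_i c i 0 * p i y) by exact/funext.
  exact: wpair_affinel.
pose b := \col_j wpair D w g (q j).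
have bE : b = U *m beta hM u D w q g.
  suff -> : beta hM u D w q g = invmx U *m b by rewrite mulKVmx.
  apply/colP => k; rewrite !mxE; under eq_bigr do rewrite mxE.
  rewrite -(wpair_lincombr mD (invmx U k) hgq); congr wpair.
  by apply/funext => y; rewrite mxE; apply: eq_bigr => j _; rewrite mxE.
have coefE : \col_j wpair D w f (q j) = z *: (U *m a).
  transitivity (- z^-1 *: b + Bmatrix D w p q *m c).
    apply/colP => j; rewrite !mxE (fq j).2; congr (_ + _).
    by apply: eq_bigr => i _; rewrite [Bmatrix _ _ _ _ j i]mxE mulrC.
  rewrite /c !mulmxA (mulmx_Umatrix hM hchain) -/U bE -!mulmxA scaleNr.
  by rewrite scalemxAr -aE mulmxBr -scalemxAr opprB subrK.
move=> x Dx; have [Ki ->] := integral_operator_separable mD p A x (fun j => (fq j).1).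
split=> //; rewrite coefE -/(f x) fE mulrDr mulrA mulrN mulfV // mulN1r.
rewrite -scalemxAr mulmxA -/c addrAC addNr add0r mulr_sumr.
by apply: eq_bigr => i _; rewrite [(z *: c) i 0]mxE mulrCA (mulrC (p i x)).
Qed.
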